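(* Let $N\ge2$ and $n\ge1$. There exists a unique quantum partial trace $$\operatorname{qptr}_{\widetilde V_N^{\otimes n}}:\operatorname{End}(\widetilde V_N^{\otimes(n+1)})\to\operatorname{End}(\widetilde V_N^{\otimes n})$$ up to a scalar. That is, a quantum partial trace exists, and for any quantum partial trace with coefficients $g_0,\dots,g_{N-1}$ one has that $g_0$ is non-zero and $g_j=g_0\,q^{-2j}$ for all $0\le j\le N-1$.
   Context: Let $L=\mathbb Q[q^{\pm2},s^{\pm2}]\subset A=\mathbb Q[q^{\pm1},s^{\pm1}]$, $\varphi_d$ the $d$-th cyclotomic polynomial, and $$\widetilde{\mathcal I}_N=\bigl(\varphi_N(q^2)(s^2q^{-2N+2}-1)\bigr)\cap\prod_{d\mid N,\ d\ne1,N}\Bigl(\varphi_d(q^2),\ \tfrac{s^{2d}-1}{s^2-1}\Bigr)\subseteq L$$ (empty product $=L$). Put $\widetilde A_N=A/\widetilde{\mathcal I}_NA$. $[m]_q=\frac{q^m-q^{-m}}{q-q^{-1}}$, $[m]_q!=[1]_q\cdots[m]_q$, ${m\brack j}_q=\frac{[m]_q!}{[m-j]_q!\,[j]_q!}$. On the free $A$-module $\hat V$ with basis $v_0,v_1,\dots$ let $$R(v_i\otimes v_j)= s^{-(i+j)} \sum_{m=0}^{i} q^{2(i-m)(j+m)}q^{\frac{m(m-1)}{2}} {m+j \brack j}_q \prod_{k=0}^{m-1}(sq^{-k-j}-s^{-1}q^{k+j}) \ v_{j+m}\otimes v_{i-m},$$ $$R^{-1}(v_i\otimes v_j)= s^{i+j}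 \sum_{m=0}^{j} (-1)^{m}q^{-2ij}q^{-\frac{m(m-1)}{2}} {m+i \brack i}_q \prod_{k=0}^{m-1}(sq^{-i-k}-s^{-1}q^{k+i}) \ v_{j-m}\otimes v_{i+m}.$$ Let $\widetilde V_N$ be the $\widetilde A_N$-submodule of $\hat V\otimes_A\widetilde A_N$ spanned by $v_0,\dots,v_{N-1}$. The operators $\mathrm{Id}^{\otimes(i-1)}\otimes R^{\pm1}\otimes\mathrm{Id}^{\otimes(n-i-1)}$ preserve $\widetilde V_N^{\otimes n}$ and define a representation $\widetilde\rho_{N,n}:B_n\to\operatorname{Aut}_{\widetilde A_N}(\widetilde V_N^{\otimes n})$, $\sigma_i^{\pm1}\mapsto\mathrm{Id}^{\otimes(i-1)}\otimes R^{\pm1}\otimes\mathrm{Id}^{\otimes(n-i-1)}$. For $f\in\operatorname{End}(\widetilde V_N^{\otimes n})$ let $f_{v_{i_1,\dots,i_n}}^{v_{j_1,\dots,j_n}}$ be the coefficient of $v_{j_1}\otimes\cdots\otimes v_{j_n}$ in $f(v_{i_1}\otimes\cdots\otimes v_{i_n})$. A quantum partial trace is a map $\operatorname{qptr}:\operatorname{End}(\widetilde V_N^{\otimes(n+1)})\to\operatorname{End}(\widetilde V_N^{\otimes n})$ of the form $$\operatorname{qptr}(f)_{v_{i_1,\dots,i_n}}^{v_{j_1,\dots,j_n}}=\sum_{j=0}^{N-1}g_j\, f_{v_{i_1,\dots,i_n,j}}^{v_{j_1,\dots,j_n,j}}$$ for some scalars $g_j\in\widetilde A_N$, for which there is an invertible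 (non-zero) $a\in\widetilde A_N$ such that for every $\beta\in B_n$ (viewed in $B_{n+1}$ via the standard inclusion) $$\operatorname{qptr}(\widetilde\rho_{N,n+1}(\sigma_n\beta))=a\,\widetilde\rho_{N,n}(\beta),\qquad \operatorname{qptr}(\widetilde\rho_{N,n+1}(\sigma_n^{-1}\beta))=a^{-1}\,\widetilde\rho_{N,n}(\beta).$$ *)

(* Defs.v *)
From HB Require Import structures.
From mathcomp Require Import all_boot all_order all_algebra cyclotomic.
From mathcomp Require Import generic_quotient ring_quotient.
From mathcomp Require Import boolp classical_sets ring.

Set Implicit Arguments.
Unset Strict Implicit.
Unset Printing Implicit Defensive.

Import Order.TTheory GRing.Theory Num.Theory.
Local Open Scope ring_scope.
Local Open Scope classical_set_scope.

Section Ideals.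

Variable K : comNzRingType.

(* The S-submodule of K spanned by X: for a subring S of K and X `<=` S, this
   is the ideal of S generated by X. *)
Definition ideal_gen (S X : set K) : set K :=
  [set x | exists r : seq (K * K),
     (forall t, t \in r -> S t.1 /\ X t.2) /\ x = \sum_(t <- r) t.1 * t.2].

Definition ideal_mul (S I J : set K) : set K :=
  ideal_gen S [set z | exists x y, [/\ I x, J y & z = x * y]].

End Ideals.

(* Everything below lives in a field K over rat; it is instantiated further
   down with K = Q(q, s). *)
Section Generic.

Variables (K : fieldType) (c : {rmorphism rat -> K}).

(* The subring Q[u^{+-1}, v^{+-1}] of K: finite sums of rational multiples of
   Laurent monomials in u and v. *)
Definition laurent (u v : K) : set K :=
  [set x | exists r : seq (rat * (int * int)),
     x = \sum_(t <- r) c t.1 * (u ^ t.2.1 * v ^ t.2.2)].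

Variables q s : K.

Definition cyclo_q2 (d : nat) : K := (map_poly intr 'Phi_d).[q ^+ 2].

Definition Itilde_gen (N : nat) : set K :=
  let L := laurent (q ^+ 2) (s ^+ 2) in
  ideal_gen L [set cyclo_q2 N * (s ^+ 2 * q ^ (2 - (2 * N)%N%:Z) - 1)] `&`
  \big[ideal_mul L/L]_(d <- divisors N | (d != 1%N) && (d != N))
    ideal_gen L [set cyclo_q2 d; (s ^+ (2 * d) - 1) / (s ^+ 2 - 1)].

Definition qint (m : nat) : K := (q ^+ m - q ^- m) / (q - q^-1).
Definition qfact (m : nat) : K := \prod_(1 <= k < m.+1) qint k.
Definition qbin (m j : nat) : K := qfact m / (qfact (m - j) * qfact j).

(* The coefficient of v_k (x) v_l in R(v_i (x) v_j); all indices are naturals,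
   i.e. this describes R on V^ (x) V^. *)
Definition Rcoef_gen (i j k l : nat) : K :=
  s ^- (i + j) *
  \sum_(m < i.+1 | (k == j + m)%N && (l == i - m)%N)
    q ^+ (2 * (i - m) * (j + m)) * q ^+ (m * m.-1)./2 * qbin (m + j) j *
    \prod_(a < m) (s * q ^- (a + j) - s^-1 * q ^+ (a + j)).

(* The coefficient of v_k (x) v_l in R^{-1}(v_i (x) v_j). *)
Definition Rinvcoef_gen (i j k l : nat) : K :=
  s ^+ (i + j) *
  \sum_(m < j.+1 | (k == j - m)%N && (l == i + m)%N)
    (-1) ^+ m * q ^- (2 * i * j) * q ^- (m * m.-1)./2 * qbin (m + i) i *
    \prod_(a < m) (s * q ^- (i + a) - s^-1 * q ^+ (i + a)).

Section LaurentTheory.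

Variables (u v : K).
Hypotheses (u0 : u != 0) (v0 : v != 0).

Lemma laurent_monomial a b : laurent u v (u ^ a * v ^ b).
Proof. by exists [:: (1, (a, b))]; rewrite big_seq1 rmorph1 mul1r. Qed.

Lemma laurent1 : laurent u v 1.
Proof. by have := laurent_monomial 0 0; rewrite !expr0z mul1r. Qed.

Lemma laurentD x y : laurent u v x -> laurent u v y -> laurent u v (x + y).
Proof. by move=> [r ->] [r' ->]; exists (r ++ r'); rewrite big_cat. Qed.

Lemma laurentN x : laurent u v x -> laurent u v (- x).
Proof.
move=> [r ->]; exists [seq (- t.1, t.2) | t <- r].
by rewrite big_map -sumrN; apply: eq_bigr => t _; rewrite rmorphN mulNr.
Qed.

Lemma laurentM x y : laurent u v x -> laurent u v y -> laurent u v (x * y).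
Proof.
move=> [r ->] [r' ->].
exists [seq (t.1 * t'.1, (t.2.1 + t'.2.1, t.2.2 + t'.2.2)) | t <- r, t' <- r'].
rewrite big_allpairs_dep mulr_suml; apply: eq_bigr => t _.
rewrite mulr_sumr; apply: eq_bigr => t' _ /=.
by rewrite rmorphM !expfzDr // mulrACA; congr (_ * _); rewrite mulrACA.
Qed.

Lemma laurent_subring (P : {pred K}) :
  (forall x, reflect (laurent u v x) (x \in P)) -> subring_closed P.
Proof.
move=> PP; split=> [|x y /PP Ax /PP Ay|x y /PP Ax /PP Ay]; apply/PP.
- exact: laurent1.
- by apply: laurentD => //; apply: laurentN.
- exact: laurentM.
Qed.

End LaurentTheory.

Hypotheses (q0 : q != 0) (s0 : s != 0).
Hypothesis q_nroot1 : forall m, (0 < m)%N -> q ^+ m != 1.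

Let A := laurent q s.

Section RcoefLaurent.

Variable P : subringClosed K.
Hypothesis Pqs : forall a b : int, q ^ a * s ^ b \in P.

Let Pqz (a : int) : q ^ a \in P.
Proof. by have := Pqs a 0; rewrite expr0z mulr1. Qed.
Let Psz (b : int) : s ^ b \in P.
Proof. by have := Pqs 0 b; rewrite expr0z mul1r. Qed.
Let Pq n : q ^+ n \in P. Proof. exact: (Pqz n). Qed.
Let Ps n : s ^+ n \in P. Proof. exact: (Psz n). Qed.
Let PqV n : q ^- n \in P. Proof. by rewrite exprnN. Qed.
Let PsV n : s ^- n \in P. Proof. by rewrite exprnN. Qed.
Let PsV1 : s^-1 \in P. Proof. by have := PsV 1; rewrite expr1. Qed.
Let Ps1 : s \in P. Proof. by have := Ps 1; rewrite expr1. Qed.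

Let qint_neq0 m : (0 < m)%N -> qint m != 0.
Proof.
have H n : (0 < n)%N -> q ^+ n - q ^- n != 0.
  move=> n0; rewrite subr_eq0; apply: contraNneq (q_nroot1 (m := n + n) _).
    by move=> E; rewrite exprD {1}E mulVf ?expf_neq0.
  by rewrite addn_gt0 n0.
by move=> m0; rewrite mulf_neq0 ?invr_eq0 ?H // (H 1%N).
Qed.

Let qfact_neq0 m : qfact m != 0.
Proof.
rewrite /qfact prodf_seq_neq0; apply/allP => k; rewrite mem_index_iota => /andP[k0 _].
by apply/implyP => _; apply: qint_neq0.
Qed.

Let qfact0 : qfact 0 = 1.
Proof. by rewrite /qfact big_geq. Qed.

Let qfactS m : qfact m.+1 = qfact m * qint m.+1.
Proof. by rewrite /qfact big_nat_recr. Qed.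

Let qintD m j : qint (m + j) = q ^+ j * qint m + q ^- m * qint j.
Proof.
rewrite /qint !mulrA -mulrDl; congr (_ / _).
by rewrite exprD invfM; ring.
Qed.

Lemma qbin_closed m j : qbin (m + j) j \in P.
Proof.
elim: m j => [|m IHm] j.
  by rewrite /qbin addnK add0n qfact0 mul1r divff ?rpred1.
elim: j => [|j IHj].
  by rewrite /qbin addnK addn0 qfact0 mulr1 divff ?rpred1.
suff -> : qbin (m.+1 + j.+1) j.+1 =
    q ^+ j.+1 * qbin (m + j.+1) j.+1 + q ^- m.+1 * qbin (m.+1 + j) j.
  by apply: rpredD; apply: rpredM.
have -> : qbin (m.+1 + j.+1) j.+1 = qfact (m + j.+1) * qint (m.+1 + j.+1) /
    (qfact m.+1 * qfact j.+1) by rewrite /qbin addnK -qfactS -addSn.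
rewrite /qbin !addnK qintD addSnnS !qfactS.
have [Hm Hj] := (qint_neq0 (ltn0Sn m), qint_neq0 (ltn0Sn j)).
by field; rewrite !qfact_neq0 Hm Hj ?expf_neq0.
Qed.

Let Pfactor n : s * q ^- n - s^-1 * q ^+ n \in P.
Proof. by apply: rpredB; apply: rpredM. Qed.

Lemma Rcoef_closed i j k l : Rcoef_gen i j k l \in P.
Proof.
apply: rpredM => //; apply: rpred_sum => m _.
apply: rpredM; last by apply: rpred_prod => a _.
by apply: rpredM; [apply: rpredM | apply: qbin_closed].
Qed.

Lemma Rinvcoef_closed i j k l : Rinvcoef_gen i j k l \in P.
Proof.
apply: rpredM => //; apply: rpred_sum => m _.
apply: rpredM; last by apply: rpred_prod => a _.
apply: rpredM; last exact: qbin_closed.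
by apply: rpredM => //; apply: rpredM => //; rewrite rpredX ?rpredN ?rpred1.
Qed.

End RcoefLaurent.

(* All elements of the ideal generated by Itilde_gen N vanish at q = s = 1. *)
Section Proper.

Variable frac : {rmorphism {poly {poly rat}} -> K}.
Hypothesis frac_inj : injective frac.
Hypotheses (cE : forall x, c x = frac x%:P%:P) (qE : q = frac 'X%:P) (sE : s = frac 'X).

Let X : {poly {poly rat}} := 'X%:P.
Let Y : {poly {poly rat}} := 'X.
Let ev (p : {poly {poly rat}}) : rat := p.[1].[1].

Let evD p p' : ev (p + p') = ev p + ev p'.
Proof. by rewrite /ev !hornerD. Qed.
Let evM p p' : ev (p * p') = ev p * ev p'.
Proof. by rewrite /ev !hornerM. Qed.
Let evN p : ev (- p) = - ev p.
Proof. by rewrite /ev !hornerN. Qed.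
Let evXn p n : ev (p ^+ n) = ev p ^+ n.
Proof. by rewrite /ev !horner_exp. Qed.
Let evX : ev X = 1.
Proof. by rewrite /ev hornerC hornerX. Qed.
Let evY : ev Y = 1.
Proof. by rewrite /ev hornerX -[1]polyC1 hornerC. Qed.
Let evXYn n : ev ((X * Y) ^+ n) = 1.
Proof. by rewrite evXn evM evX evY mulr1 expr1n. Qed.

Let fracXY n : (q * s) ^+ n = frac ((X * Y) ^+ n).
Proof. by rewrite rmorphXn rmorphM qE sE. Qed.

Let num (x : K) := exists n p, x * (q * s) ^+ n = frac p.
Let numv (x : K) := exists n p, x * (q * s) ^+ n = frac p /\ ev p = 0.

Let numD x y : num x -> num y -> num (x + y).
Proof.
move=> [n [p Hp]] [m [r Hr]]; exists (n + m)%N, (p * (X * Y) ^+ m + r * (X * Y) ^+ n).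
rewrite exprD mulrDl {1}mulrA Hp [_ ^+ n * _]mulrC mulrA Hr !fracXY.
by rewrite rmorphD !rmorphM.
Qed.

Let numvD x y : numv x -> numv y -> numv (x + y).
Proof.
move=> [n [p [Hp Ep]]] [m [r [Hr Er]]].
exists (n + m)%N, (p * (X * Y) ^+ m + r * (X * Y) ^+ n); split; last first.
  by rewrite evD !evM Ep Er !mul0r addr0.
rewrite exprD mulrDl {1}mulrA Hp [_ ^+ n * _]mulrC mulrA Hr !fracXY.
by rewrite rmorphD !rmorphM.
Qed.

Let numvM x y : num x -> numv y -> numv (x * y).
Proof.
move=> [n [p Hp]] [m [r [Hr Er]]]; exists (n + m)%N, (p * r); split.
  by rewrite exprD mulrACA Hp Hr rmorphM.
by rewrite evM Er mulr0.
Qed.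

Let num_monomial d a b : num (c d * (q ^ a * s ^ b)).
Proof.
have [i Hi] : exists n : nat, (0 <= a + n%:Z) && (0 <= b + n%:Z).
  exists (`|a| + `|b|)%N; rewrite PoszD !abszE -lerBlDl -[0 <= b + _]lerBlDl !sub0r.
  have Hn (x : int) : - x <= `|x| by rewrite -normrN ler_norm.
  by rewrite ler_wpDr ?ler_wpDl ?normr_ge0 ?Hn.
case/andP: Hi; case Ea: (a + i%:Z) => [a'|//] _; case Eb: (b + i%:Z) => [b'|//] _.
exists i, (d%:P%:P * (X ^+ a' * Y ^+ b')).
rewrite exprMn -mulrA [X in _ * X]mulrACA [q ^+ i]exprnP [s ^+ i]exprnP.
rewrite -!expfzDr // Ea Eb -!exprnP cE qE sE.
by rewrite !rmorphM !rmorphXn.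
Qed.

Let num_A x : A x -> num x.
Proof.
move=> [r ->]; elim: r => [|t r IHr].
  by rewrite big_nil; exists 0, 0; rewrite mul0r rmorph0.
by rewrite big_cons; apply: numD.
Qed.

Let sub_LA x : laurent (q ^+ 2) (s ^+ 2) x -> A x.
Proof.
move=> [r ->]; exists [seq (t.1, (2 * t.2.1, 2 * t.2.2)) | t <- r].
by rewrite big_map; apply: eq_bigr => t _; rewrite -!exprz_exp -!exprnP.
Qed.

Let num_phi N : exists p, cyclo_q2 N = frac p.
Proof.
rewrite /cyclo_q2; elim/poly_ind: ('Phi_N) => [|p a [r IHp]].
  by exists 0; rewrite map_poly0 horner0 rmorph0.
exists (r * X ^+ 2 + a%:~R).
rewrite rmorphD rmorphM /= map_polyX map_polyC hornerD hornerM hornerX hornerC IHp.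
by rewrite rmorphD rmorphM rmorphXn rmorph_int qE.
Qed.

Let numv_gen N : numv (cyclo_q2 N * (s ^+ 2 * q ^ (2 - (2 * N)%N%:Z) - 1)).
Proof.
have [p ->] := num_phi N.
exists (2 * N)%N, (p * (Y ^+ 2 * X ^+ 2 * Y ^+ (2 * N) - (X * Y) ^+ (2 * N))).
split; last first.
  by rewrite evM evD evN evXYn !evM !evXn evX evY !expr1n !mulr1 subrr mulr0.
rewrite -mulrA rmorphM; congr (_ * _).
rewrite mulrBl mul1r rmorphB -fracXY; congr (_ - _).
rewrite exprMn mulrA -[X in X * _]mulrA [q ^+ (2 * N)]exprnP.
rewrite -expfzDr // subrK.
by rewrite !rmorphM !rmorphXn qE sE.
Qed.

Let numv_Itilde N x : ideal_gen A (Itilde_gen N) x -> numv x.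
Proof.
have numv0 : numv 0.
  by exists 0, 0; split; rewrite ?mul0r ?rmorph0 // /ev !horner0.
move=> [r [Hr ->]]; elim: r Hr => [|t r IHr] Hr; first by rewrite big_nil.
rewrite big_cons; apply: numvD; last first.
  by apply: IHr => u ur; apply: Hr; rewrite inE ur orbT.
have [At [[r' [Hr' ->]] _]] := Hr t (mem_head _ _).
apply: numvM (num_A At) _; elim: r' Hr' {Hr} => [|u r' IHr'] Hr'.
  by rewrite big_nil.
rewrite big_cons; apply: numvD; last first.
  by apply: IHr' => w wr; apply: Hr'; rewrite inE wr orbT.
have [Lu ->] := Hr' u (mem_head _ _).
exact: numvM (num_A (sub_LA Lu)) (numv_gen N).
Qed.

Lemma Itilde_proper N : ~ ideal_gen A (Itilde_gen N) 1.
Proof.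
move=> /numv_Itilde [n [p [Hp Ep]]]; move: Hp; rewrite mul1r fracXY => /frac_inj Hp.
by have := evXYn n; rewrite Hp Ep => /eqP; rewrite eq_sym oner_eq0.
Qed.

End Proper.

Lemma ideal_gen0 (J : set K) : ideal_gen A J 0.
Proof. by exists [::]; split=> //; rewrite big_nil. Qed.

Lemma ideal_genMD (J : set K) a x y :
  A a -> ideal_gen A J x -> ideal_gen A J y -> ideal_gen A J (a * x + y).
Proof.
move=> Aa [r [Hr ->]] [r' [Hr' ->]].
exists ([seq (a * t.1, t.2) | t <- r] ++ r'); split.
  move=> t; rewrite mem_cat => /orP [/mapP [t' t'r ->] /=|/Hr' //].
  by have [At Xt] := Hr _ t'r; split => //; apply: laurentM.
rewrite big_cat big_map mulr_sumr; congr (_ + _).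
by apply: eq_bigr => t _; rewrite mulrA.
Qed.

End Generic.

(* The field Q(q, s); q is the inner polynomial variable and s the outer one. *)
Definition K : fieldType := {fraction {poly {poly rat}}}.

Definition frac : {rmorphism {poly {poly rat}} -> K} :=
  @FracField.tofrac {poly {poly rat}}.
Definition ratK : {rmorphism rat -> K} := frac \o (polyC \o polyC).
Definition q : K := frac 'X%:P.
Definition s : K := frac 'X.

Lemma frac_inj : injective frac.
Proof. by move=> x y /eqP; rewrite tofrac_eq => /eqP. Qed.

Lemma q_neq0 : q != 0.
Proof. by rewrite tofrac_eq0 polyC_eq0 polyX_eq0. Qed.

Lemma s_neq0 : s != 0.
Proof. by rewrite tofrac_eq0 polyX_eq0. Qed.

Lemma q_nroot1 m : (0 < m)%N -> q ^+ m != 1.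
Proof.
move=> m0; rewrite -(rmorph1 frac) -rmorphXn (inj_eq frac_inj) -rmorphXn /=.
rewrite -[1]polyC1 (inj_eq (@polyC_inj _)); apply/negP => /eqP.
by move=> /(congr1 (fun p : {poly rat} => size p)); rewrite size_polyXn size_poly1; case: m m0.
Qed.

Definition Apred : {pred K} := fun x => `[< laurent ratK q s x >].

Lemma ApredP x : reflect (laurent ratK q s x) (x \in Apred).
Proof. exact: asboolP. Qed.

HB.instance Definition _ := GRing.isSubringClosed.Build K Apred
  (laurent_subring q_neq0 s_neq0 ApredP).

Definition A : Type := {x : K | x \in Apred}.
HB.instance Definition _ := SubChoice.on A.
Definition inA (x : K) (Ax : x \in Apred) : A := exist (fun y => y \in Apred) x Ax.
HB.instance Definition _ := [SubChoice_isSubComNzRing of A by <:].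

Definition Itilde : nat -> set K := Itilde_gen ratK q s.

Definition ItildeA (N : nat) : {pred A} :=
  fun x => `[< ideal_gen (laurent ratK q s) (Itilde N) (val x) >].

Lemma ItildeA_closed N : idealr_closed (ItildeA N).
Proof.
split.
- by apply/asboolP; rewrite rmorph0; apply: ideal_gen0.
- apply/asboolP; rewrite rmorph1.
  exact: (Itilde_proper q_neq0 s_neq0 frac_inj).
- move=> a u v /asboolP Iu /asboolP Iv; apply/asboolP; rewrite rmorphD rmorphM.
  by apply: (ideal_genMD q_neq0 s_neq0) => //; apply/ApredP; apply: valP.
Qed.

HB.instance Definition _ N := isIdealr.Build A (ItildeA N) (ItildeA_closed N).

Definition AN (N : nat) : comNzRingType := {ideal_quot (ItildeA N)}.
Definition toAN (N : nat) : {rmorphism A -> AN N} := \pi_({ideal_quot (ItildeA N)})%qT.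

Lemma Apred_monomial a b : q ^ a * s ^ b \in Apred.
Proof. by apply/ApredP; apply: laurent_monomial. Qed.

Definition monomial (a b : int) : A := inA (Apred_monomial a b).

(* Coefficients of R (for e = true) and R^{-1} (for e = false). *)
Definition Rcoef (e : bool) (i j k l : nat) : A :=
  if e then inA (Rcoef_closed q_neq0 q_nroot1 Apred_monomial i j k l)
  else inA (Rinvcoef_closed q_neq0 q_nroot1 Apred_monomial i j k l).

(* The n-th tensor power of V~_N: the free AN-module with basis
   v_I = v_{i_1} (x) ... (x) v_{i_n} indexed by the n-tuples I over {0..N-1}. *)
Definition tens (N n : nat) := {ffun n.-tuple 'I_N -> (AN N)^o}.

Definition vbasis N n (I : n.-tuple 'I_N) : tens N n := [ffun J => (J == I)%:R].

(* mcoef f I J is the coefficient of v_J in f(v_I). *)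
Definition mcoef N n (f : {linear tens N n -> tens N n}) (I J : n.-tuple 'I_N) :
  AN N := f (vbasis I) J.

(* The k-th (counting from 0) entry of I. *)
Definition entry N n (I : n.-tuple 'I_N) (k : nat) : nat := nth 0%N (map val I) k.

(* The coefficient of v_J in the image of v_I by Id^(i-1) (x) R^{+-1} (x)
   Id^(n-i-1), the factors being numbered from 1. As R^{+-1} preserves
   V~_N (x) V~_N inside V^ (x) V^, the matrix of its restriction consists of
   the coefficients of R^{+-1} with all indices < N. *)
Definition sigma_coef N n (e : bool) (i : nat) (I J : n.-tuple 'I_N) : AN N :=
  if [forall k : 'I_n, (k != i.-1 :> nat) && (k != i :> nat) ==>
                       (tnth I k == tnth J k)]
  then toAN N (Rcoef e (entry I i.-1) (entry I i) (entry J i.-1) (entry J i))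
  else 0.

Definition sigma_fun N n (e : bool) (i : nat) (x : tens N n) : tens N n :=
  [ffun J => \sum_I x I * sigma_coef e i I J].

Lemma sigma_fun_linear N n e i : linear (@sigma_fun N n e i).
Proof.
move=> a x y; apply/ffunP => J; rewrite !ffunE scaler_sumr -big_split /=.
by apply: eq_bigr => I _; rewrite !ffunE mulrDl scalerAl.
Qed.

HB.instance Definition _ N n e i := GRing.isLinear.Build (AN N) (tens N n)
  (tens N n) *:%R (@sigma_fun N n e i) (@sigma_fun_linear N n e i).

(* Elements of B_n are given by words: (i, true) stands for sigma_i and
   (i, false) for sigma_i^{-1}, 1 <= i <= n - 1. The standard inclusion of B_n
   into B_{n+1} is then the identity on words. As the operators satisfy the
   braid relations, rho depends only on the braid a word represents. *)
Definition braid_word (n : nat) : {pred seq (nat * bool)} :=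
  fun w => all (fun g => (0 < g.1 < n)%N) w.

Fixpoint rho N n (w : seq (nat * bool)) : {linear tens N n -> tens N n} :=
  if w is g :: w' then @sigma_fun N n g.2 g.1 \o rho N n w' else idfun.

Definition endo N n := {linear tens N n -> tens N n}.

Definition is_qptr N n (g : 'I_N -> AN N) (qptr : endo N n.+1 -> endo N n) : Prop :=
  (forall f I J, mcoef (qptr f) I J =
     \sum_(j < N) g j * mcoef f [tuple of rcons I j] [tuple of rcons J j]) /\
  exists a a' : AN N, a * a' = 1 /\
    forall w, w \in braid_word n ->
      qptr (rho N n.+1 ((n, true) :: w)) =1 a \*: rho N n w /\
      qptr (rho N n.+1 ((n, false) :: w)) =1 a' \*: rho N n w.

(* Main.v *)
(** Applied to the trivial braid, a quantum partial trace of [sigma_n] forces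
    [\sum_(j <= i) g_j R_ij = a] for every [i < N], where [R_ij] is the
    coefficient of [v_i (x) v_j] in [R (v_i (x) v_j)].  This system is triangular
    with invertible diagonal, and [i = 0] reads [g_0 = a]; hence everything follows
    from [\sum_(j <= i) q^(-2j) R_ij = 1], a q-binomial identity.  Conversely,
    partial traces of [sigma_n^(+-1) beta] reduce to those of [sigma_n^(+-1)],
    which are diagonal, so it remains to compute
    [T_i = \sum_(i <= j < N) q^(-2j) R^-1_ij].  The difference [T_i - T_(i+1)] is,
    up to a unit, [binom(N, i+1)_(q^2) \prod_(i < k < N) (1 - s^2 q^(-2k))], which
    lies in the ideal: for [d] dividing [N], either [d] does not divide [i+1] and
    [phi_d(q^2)] divides the binomial, or [d] consecutive factors of the product
    multiply to [1 - s^(2d)] modulo [phi_d(q^2)].  Thus all [T_i] agree with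
    [T_(N-1) = (s^2 q^(-2N))^(N-1)], and the square root of its inverse is the
    right choice of [g_0 = a]. *)
Require Import Defs.
From HB Require Import structures.
From mathcomp Require Import all_boot all_order all_algebra.
From mathcomp Require Import cyclotomic algC separable.
From mathcomp Require Import ring_quotient boolp classical_sets ring zify.

Set Implicit Arguments.
Unset Strict Implicit.
Unset Printing Implicit Defensive.

Import GRing.Theory Num.Theory.
Local Open Scope ring_scope.

(** * Gaussian binomials *)

(** The Pascal recursion needs no division, so these binomials can be evaluated at roots of unity
    and transported along ring morphisms. *)
Fixpoint gauss (R : comNzRingType) (x : R) (n k : nat) : R :=
  match n, k with
  | _, 0 => 1
  | 0, _.+1 => 0
  | n'.+1, k'.+1 => gauss x n' k' + x ^+ k * gauss x n' k
  end.

Section GaussianBinomials.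

Variables (R : comNzRingType) (x z : R).

Lemma gauss0 n : gauss x n 0 = 1.
Proof. by case: n. Qed.

Lemma gaussS n k : gauss x n.+1 k.+1 = gauss x n k + x ^+ k.+1 * gauss x n k.+1.
Proof. by []. Qed.

Lemma gauss_small n k : (n < k)%N -> gauss x n k = 0.
Proof.
elim: n k => [|n IHn] [|k] //; rewrite ltnS => nk.
by rewrite gaussS !IHn ?mulr0 ?addr0 // ltnW.
Qed.

Lemma gauss_nn n : gauss x n n = 1.
Proof. by elim: n => // n IHn; rewrite gaussS IHn gauss_small // mulr0 addr0. Qed.

(** The second Pascal rule, usually written with the power x^(n-k); the factor x^k avoids truncated
    subtraction. *)
Lemma gaussS_dual n k :
  x ^+ k * gauss x n.+1 k.+1 = x ^+ n * gauss x n k + x ^+ k * gauss x n k.+1.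
Proof.
elim: n k => [|n IHn] k.
  case: k => [|k]; first by rewrite /= mulr0 addr0 mulr1 mulr0 addr0.
  by rewrite !gauss_small // !mulr0 addr0.
case: k => [|k].
  have := IHn 0; rewrite expr0 !mul1r !gauss0 !mulr1 => E.
  have D m : gauss x m.+1 1 = 1 + x * gauss x m 1 by rewrite gaussS gauss0.
  by rewrite (D n.+1) {1}E exprS mulrDr addrCA -D.
have E0 := IHn k; have E1 := IHn k.+1.
rewrite [gauss x n.+2 _]gaussS mulrDr mulrCA [in LHS]E1.
rewrite [x ^+ k.+1 * gauss x n.+1 k.+1](_ : _ = x * (x ^+ k * gauss x n.+1 k.+1)).
  by rewrite E0 !gaussS !exprS; ring.
by rewrite exprS mulrA.
Qed.

(** Subtracting the first Pascal rule from x times the dual one cancels the binomial (n, k+1). *)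
Lemma gauss_absorb n k :
  (x ^+ k.+1 - 1) * gauss x n.+1 k.+1 = (x ^+ n.+1 - 1) * gauss x n k.
Proof.
have -> : (x ^+ k.+1 - 1) * gauss x n.+1 k.+1 =
  x * (x ^+ k * gauss x n.+1 k.+1) - gauss x n.+1 k.+1 by rewrite exprS; ring.
rewrite gaussS_dual gaussS !exprS; ring.
Qed.

(** Induction on i with z replaced by z x: after Pascal's rule and an index shift, the two terms
    carrying the binomial (i, j) combine through (1 - z x^j) + z x^j = 1. *)
Lemma sum_gauss_prod i :
  \sum_(0 <= j < i.+1) z ^+ j * x ^+ (j * j.-1) * gauss x i j *
    \prod_(j <= k < i) (1 - z * x ^+ k) = 1.
Proof.
elim: i z => [|i IHi] y.
  by rewrite big_nat1 big_geq // !mulr1.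
rewrite big_nat_recl //.
under [X in _ + X]eq_bigr => j _ do rewrite gaussS mulrDr mulrDl.
rewrite big_split addrCA /=.
rewrite [X in _ + (_ + X)](_ : _ = \sum_(0 <= j < i)
   y ^+ j.+1 * x ^+ (j.+1 * j.+1) * gauss x i j.+1 *
     \prod_(j.+1 <= k < i.+1) (1 - y * x ^+ k)); last first.
  rewrite big_nat_recr //= gauss_small // !mulr0 mul0r addr0.
  by apply: eq_bigr => j _; rewrite mulnS addnC exprD; ring.
rewrite [X in _ + X](_ : _ = \sum_(0 <= j < i.+1) y ^+ j * x ^+ (j * j) *
   gauss x i j * \prod_(j <= k < i.+1) (1 - y * x ^+ k)); last first.
  by rewrite [RHS]big_nat_recl //= gauss0.
rewrite -big_split /= -[RHS](IHi (y * x)).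
apply: eq_big_nat => j /andP[_ ji].
rewrite [in X in _ + X]big_ltn // big_add1 /=.
under eq_bigr => k _ do rewrite exprS mulrA.
have E : x ^+ (j * j) = x ^+ j * x ^+ (j * j.-1).
  by rewrite -exprD; congr (_ ^+ _); case: j {ji} => // m; rewrite mulnS.
by rewrite mulSn exprD !exprS exprMn E; ring.
Qed.

(* Telescoping in [i] of the partial trace of [R^-1], with [z = s^2], [x = q^-2]. *)
Lemma sum_gauss_telescope N i : (i < N)%N ->
  \sum_(i <= j < N) z ^+ i * x ^+ (i * i + j) * gauss x j i *
     \prod_(i <= k < j) (1 - z * x ^+ k) =
  \sum_(i.+1 <= j < N) z ^+ i.+1 * x ^+ (i.+1 * i.+1 + j) * gauss x j i.+1 *
     \prod_(i.+1 <= k < j) (1 - z * x ^+ k) +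
  z ^+ i * x ^+ (i * i.+1) * gauss x N i.+1 *
     \prod_(i.+1 <= k < N) (1 - z * x ^+ k).
Proof.
move=> /subnKC <-; elim: (N - i.+1)%N => [|m IHm].
  rewrite addn0 big_nat1 [in RHS]big_geq // !gauss_nn !big_geq // add0r.
  by rewrite mulnSr.
rewrite addnS; set n := (i.+1 + m)%N in IHm *.
have lt_in : (i < n)%N by rewrite leq_addr.
clearbody n; rewrite !big_nat_recr ?(ltnW lt_in) //= IHm [in X in _ + X = _]big_ltn //.
set Sg := \sum_(i.+1 <= j < n) _; set Pi := \prod_(i.+1 <= k < n) _.
have D := gaussS_dual n i.
rewrite -/(gauss x n.+1 i.+1).
(* The product x^i [gauss x n.+1 i.+1] is isolated so that the dual Pascal rule [D] can replace
   it. *)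
have -> : z ^+ i * x ^+ (i * i.+1) * (gauss x n i + x ^+ i.+1 * gauss x n i.+1) *
    (Pi * (1 - z * x ^+ n)) = z ^+ i * x ^+ (i * i) * Pi *
    (x ^+ i * gauss x n.+1 i.+1 - x ^+ i * (z * x ^+ n) *
       (gauss x n i + x ^+ i.+1 * gauss x n i.+1)).
  by rewrite mulnSr exprD gaussS; ring.
rewrite D.
have -> : (i.+1 * i.+1 + n = i * i + i + i.+1 + n)%N by lia.
by rewrite [(i * i.+1)%N]mulnSr !exprD !exprS; ring.
Qed.

End GaussianBinomials.

Lemma rmorph_gauss (R R' : comNzRingType) (f : {rmorphism R -> R'}) x n k :
  f (gauss x n k) = gauss (f x) n k.
Proof.
elim: n k => [|n IHn] [|k] /=; rewrite ?rmorph0 ?rmorph1 //.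
by rewrite rmorphD rmorphM rmorphXn !IHn.
Qed.

(** * The ideal of relations *)

Section CyclotomicDivisibility.

Definition phiQ (d : nat) : {poly rat} := map_poly intr 'Phi_d.

(** The cyclotomic polynomial is the minimal polynomial of z over the rationals, so divisibility can
    be tested at one complex root. *)
Lemma phiQ_dvdE d (z : algC) (p : {poly rat}) : d.-primitive_root z ->
  (phiQ d %| p) = root (map_poly ratr p) z.
Proof.
move=> zP; have [p0 [Dp0 _] ->] := minCpolyP z; congr (_ %| p).
apply: (map_inj_poly (@fmorph_inj _ _ (@ratr algC))); first exact: rmorph0.
rewrite -Dp0 (minCpoly_cyclotomic zP) -(Cintr_Cyclotomic zP) -map_poly_comp.
by apply: eq_map_poly => a; rewrite /= rmorph_int.
Qed.

(** At a primitive d-th root z, absorption gives (z^k - 1) [gauss z N k] = 0, because z^N = 1, while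
    z^k is not 1. *)
Lemma phiQ_gauss d N k : (0 < N)%N -> (d %| N)%N -> ~~ (d %| k)%N ->
  phiQ d %| gauss 'X N k.
Proof.
move=> N0 dN dk; have [z zP] := C_prim_root_exists (dvdn_gt0 N0 dN).
rewrite (phiQ_dvdE _ zP) rootE.
rewrite -[_.[z]]/((horner_eval z \o map_poly ratr) (gauss 'X N k)) rmorph_gauss /=.
rewrite map_polyX /horner_eval hornerX.
case: N N0 dN => // N _ dN; case: k dk => [|k] dk; first by rewrite dvdn0 in dk.
have /eqP := gauss_absorb z N k; move: dN dk; rewrite !(prim_order_dvd zP).
move=> /eqP -> /negPf zk; rewrite subrr mul0r mulf_eq0 subr_eq0.
by rewrite zk.
Qed.

(** All these factors occur once in X^N - 1, which is separable in characteristic 0. *)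
Lemma coprimep_phiQ N d (r : seq nat) : (0 < N)%N -> uniq (d :: r) ->
  all (dvdn^~ N) (d :: r) -> coprimep (phiQ d) (\prod_(e <- r) phiQ e).
Proof.
move=> N0 ur /allP rN.
have sepN : separable_poly ('X^N - 1 : {poly rat}).
  by apply: separable_Xn_sub_1; rewrite pnatr_eq0 -lt0n.
have sub : \prod_(e <- d :: r) phiQ e %| 'X^N - 1.
  have -> : 'X^N - 1 = \prod_(e <- divisors N) phiQ e.
    rewrite -rmorph_prod prod_Cyclotomic // rmorphB rmorph1 /=.
    by rewrite map_polyXn.
  rewrite [X in _ %| X](perm_big (d :: r ++ [seq e <- divisors N | e \notin d :: r])) /=.
    by rewrite -cat_cons big_cat dvdp_mulIl.
  rewrite -cat_cons; apply: uniq_perm; rewrite ?divisors_uniq //.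
    rewrite cat_uniq ur filter_uniq ?divisors_uniq // andbT -all_predC.
    by apply/allP => e; rewrite mem_filter => /andP[].
  move=> e; rewrite mem_cat mem_filter -dvdn_divisors //.
  by case er: (e \in d :: r); rewrite //= (rN e).
move: (dvdp_separable sub sepN); rewrite big_cons separable_mul.
by case/and3P.
Qed.

(** At a primitive d-th root z one has z^k = 1, so the d consecutive powers of z run over all roots
    of Y^d - 1. *)
Lemma prod_XnsubY_mod_phiQ d k : (0 < d)%N -> (d %| k)%N ->
  exists p : {poly {poly rat}}, \prod_(k <= l < k + d) (('X^l)%:P - 'X) =
    (-1) ^+ d * ('X^d - 1) + (phiQ d)%:P * p.
Proof.
move=> d0 dk; have [z zP] := C_prim_root_exists d0.
set f := \prod_(_ <= _ < _) _; set g := (-1) ^+ d * _.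
pose ev : {rmorphism {poly rat} -> algC} := horner_eval z \o map_poly ratr.
have evX : ev 'X = z by rewrite /= map_polyX /horner_eval hornerX.
have evE (p : {poly rat}) : ev p = 0 -> phiQ d %| p.
  by rewrite (phiQ_dvdE p zP) => /eqP.
clearbody ev; have fg : map_poly ev f = map_poly ev g.
  rewrite /f /g rmorph_prod rmorphM rmorphXn rmorphN1 rmorphB rmorph1 /=.
  rewrite map_polyXn -(factor_Xn_sub_1 zP) -{1}[k]add0n big_addn addKn.
  rewrite -[d in (-1) ^+ d]subn0 -prodr_const_nat -big_split /=.
  apply: eq_bigr => l _; rewrite rmorphB /= map_polyX map_polyC /= rmorphXn evX exprD.
  by move: dk; rewrite (prim_order_dvd zP) => /eqP ->; rewrite mulr1 mulN1r opprB.
(* Every coefficient in Y of f - g vanishes at X = z, hence is divisible by [phiQ d]; p collects the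
   quotients. *)
exists (map_poly (fun a => a %/ phiQ d) (f - g)).
apply/eqP; rewrite addrC -subr_eq; apply/eqP/polyP => i.
rewrite coefCM coef_map_id0 ?div0p // mulrC divpK //; apply: evE.
by rewrite -coef_map rmorphB /= fg subrr coef0.
Qed.

End CyclotomicDivisibility.

(** * Membership in the ideals of Laurent polynomials *)

Section LaurentIdeals.

Variables (F : fieldType) (c : {rmorphism rat -> F}) (q s : F).
Hypotheses (q0 : q != 0) (s0 : s != 0) (s2n1 : s ^+ 2 != 1).

Let u0 : q ^+ 2 != 0. Proof. by rewrite expf_neq0. Qed.
Let v0 : s ^+ 2 != 0. Proof. by rewrite expf_neq0. Qed.

Let L := laurent c (q ^+ 2) (s ^+ 2).
Let J d := ideal_gen L [set cyclo_q2 q d; (s ^+ (2 * d) - 1) / (s ^+ 2 - 1)].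

Let LM x y : L x -> L y -> L (x * y). Proof. exact: laurentM. Qed.
Let LD x y : L x -> L y -> L (x + y). Proof. exact: laurentD. Qed.
Let L1 : L 1. Proof. exact: laurent1. Qed.
Let LN x : L x -> L (- x). Proof. exact: laurentN. Qed.
Let LB x y : L x -> L y -> L (x - y). Proof. by move=> *; apply/LD/LN. Qed.
Let Lq n : L ((q ^+ 2) ^+ n).
Proof. by have := laurent_monomial c (q ^+ 2) (s ^+ 2) n 0; rewrite expr0z mulr1. Qed.
Let LqV n : L ((q ^- 2) ^+ n).
Proof.
have := laurent_monomial c (q ^+ 2) (s ^+ 2) (- n%:Z) 0.
by rewrite expr0z mulr1 -exprnN exprVn.
Qed.
Let Ls n : L ((s ^+ 2) ^+ n).
Proof. by have := laurent_monomial c (q ^+ 2) (s ^+ 2) 0 n; rewrite expr0z mul1r. Qed.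

Lemma ideal_genM X a x : L a -> ideal_gen L X x -> ideal_gen L X (a * x).
Proof.
by move=> La Xx; rewrite -[_ * _]addr0; apply: ideal_genMD => //; apply: ideal_gen0.
Qed.

Lemma ideal_genD X x y : ideal_gen L X x -> ideal_gen L X y -> ideal_gen L X (x + y).
Proof. by move=> Xx Xy; rewrite -[x]mul1r; apply: ideal_genMD. Qed.

Lemma mem_ideal_gen X x : X x -> ideal_gen L X x.
Proof.
move=> Xx; exists [:: (1, x)]; rewrite big_seq1 mul1r; split=> // t.
by rewrite inE => /eqP ->.
Qed.

Lemma mem_ideal_mul I I' x y : I x -> I' y -> ideal_mul L I I' (x * y).
Proof. by move=> Ix I'y; apply: mem_ideal_gen; exists x, y. Qed.

Definition evQ : {rmorphism {poly rat} -> F} := horner_eval (q ^+ 2) \o map_poly c.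

Lemma evQ_X : evQ 'X = q ^+ 2.
Proof. by rewrite /= map_polyX /horner_eval hornerX. Qed.

Lemma evQ_phiQ d : evQ (phiQ d) = cyclo_q2 q d.
Proof.
rewrite /= /horner_eval -map_poly_comp; congr (_.[_]).
by apply: eq_map_poly => a; rewrite /= rmorph_int.
Qed.

Lemma laurent_evQ p : L (evQ p).
Proof.
elim/poly_ind: p => [|p a IHp]; first by rewrite rmorph0 -(subrr 1); apply: LB.
rewrite rmorphD rmorphM evQ_X; apply: LD; first by apply: LM (Lq 1).
rewrite /= map_polyC /horner_eval hornerC.
by exists [:: (a, (0, 0))]; rewrite big_seq1 !expr0z !mulr1.
Qed.

Lemma prod_cyclo_ideal_mul (r : seq nat) :
  (\big[ideal_mul L/L]_(d <- r) J d) (\prod_(d <- r) cyclo_q2 q d).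
Proof.
elim: r => [|d r IHr]; first by rewrite !big_nil.
rewrite !big_cons; apply: mem_ideal_mul => //.
by apply: mem_ideal_gen; left.
Qed.

(* The ideals are pairwise comaximal because distinct cyclotomic polynomials
   are coprime over [rat], so their product contains their intersection. *)
Lemma ideal_mul_comaximal N (r : seq nat) x : (0 < N)%N -> uniq r ->
  all (dvdn^~ N) r -> L x -> {in r, forall d, J d x} ->
  (\big[ideal_mul L/L]_(d <- r) J d) x.
Proof.
move=> N0 ur rN Lx; elim: r ur rN => [|d r IHr] ur rN Jx; first by rewrite big_nil.
have /Bezout_eq1_coprimepP [[a b] /= ab1] := coprimep_phiQ N0 ur rN.
(* Bezout splits x: the first summand pairs phi_d in [J d] with x in the remaining product, the
   second pairs x in [J d] with the product of the other phi_e. *)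
have -> : x = evQ a * (cyclo_q2 q d * x) +
    evQ b * (x * \prod_(e <- r) cyclo_q2 q e).
  under [in RHS]eq_bigr => e _ do rewrite -evQ_phiQ.
  rewrite -evQ_phiQ -rmorph_prod; move/(congr1 evQ): ab1.
  rewrite rmorphD !rmorphM rmorph1 => ab1; rewrite -[LHS]mul1r -ab1; ring.
move: ur rN; rewrite /= => /andP[_ ur] /andP[_ rN].
rewrite big_cons; apply: ideal_genD; (apply: ideal_genM; first exact: laurent_evQ).
- apply: mem_ideal_mul; first by apply: mem_ideal_gen; left.
  by apply: IHr => // e er; apply: Jx; rewrite inE er orbT.
- by apply: mem_ideal_mul (prod_cyclo_ideal_mul r); apply: Jx; rewrite mem_head.
Qed.

Let fac l := 1 - s ^+ 2 * (q ^- 2) ^+ l.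

Let Lfac m n : L (\prod_(m <= l < n) fac l).
Proof. by apply: big_ind => // l _; apply: LB => //; apply: LM => //; apply: (Ls 1). Qed.

(* Modulo [phi_d(q^2)], the [d] factors multiply to [1 - s^(2d)]. *)
Lemma ideal_prod_period d k : (0 < d)%N -> (d %| k)%N ->
  J d (\prod_(k <= l < k + d) fac l).
Proof.
move=> d0 dk; have [p Dp] := prod_XnsubY_mod_phiQ d0 dk.
pose ev : {rmorphism {poly {poly rat}} -> F} := horner_eval (s ^+ 2) \o map_poly evQ.
have evX : ev 'X = s ^+ 2 by rewrite /= map_polyX /horner_eval hornerX.
have evC a : ev a%:P = evQ a by rewrite /ev /= map_polyC /horner_eval hornerC.
have Lev f : L (ev f).
  elim/poly_ind: f => [|f a IHf]; first by rewrite rmorph0 -(subrr 1); apply: LB.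
  rewrite rmorphD rmorphM evX evC; apply: LD; last exact: laurent_evQ.
  by apply: LM (Ls 1).
(* Clearing the powers of q^-2, which are units of L, leaves the value of a polynomial at X = q^2, Y
   = s^2. *)
have -> : \prod_(k <= l < k + d) fac l =
    \prod_(k <= l < k + d) (q ^- 2) ^+ l *
    ev (\prod_(k <= l < k + d) (('X^l)%:P - 'X)).
  rewrite rmorph_prod -big_split /=; apply: eq_bigr => l _.
  rewrite -[horner_eval _ _]/(ev (('X^l)%:P - 'X)) rmorphB evC evX rmorphXn evQ_X.
  by rewrite /fac mulrBr -exprMn mulVf // expr1n mulrC.
apply: ideal_genM; first by apply: big_ind.
rewrite Dp rmorphD !rmorphM evC evQ_phiQ; apply: ideal_genD; last first.
  rewrite [cyclo_q2 q d * _]mulrC; apply: ideal_genM; first exact: Lev.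
  by apply: mem_ideal_gen; left.
rewrite rmorphXn rmorphN1 rmorphB rmorph1 rmorphXn evX -exprM.
have -> : (-1) ^+ d * (s ^+ (2 * d) - 1) =
    (-1) ^+ d * (s ^+ 2 - 1) * ((s ^+ (2 * d) - 1) / (s ^+ 2 - 1)).
  by field; rewrite subr_eq0.
apply: ideal_genM; last by apply: mem_ideal_gen; right.
apply: LM; last exact: LB (Ls 1) _.
by rewrite -signr_odd; case: odd; rewrite ?expr1 //; apply: LN.
Qed.

(** This is the boundary term of the telescoping sum up to a unit of A; the binomial is taken at q^2
    while the factors involve q^-2. *)
Lemma Itilde_gen_gauss N k : (0 < k < N)%N ->
  Itilde_gen c q s N (gauss (q ^+ 2) N k * \prod_(k <= l < N) fac l).
Proof.
case/andP=> k0 kN; have N0 := ltn_trans k0 kN.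
have gE : gauss (q ^+ 2) N k = evQ (gauss 'X N k) by rewrite rmorph_gauss evQ_X.
have Jgauss d : (d %| N)%N -> ~~ (d %| k)%N ->
    exists2 w, L w & gauss (q ^+ 2) N k = w * cyclo_q2 q d.
  move=> dN dk; have /dvdpP [p Dp] := phiQ_gauss N0 dN dk.
  by exists (evQ p); [apply: laurent_evQ | rewrite gE Dp rmorphM evQ_phiQ].
split.
  (* Since 0 < k < N, phi_N(q^2) divides the binomial; the factor l = N - 1 supplies, up to sign,
     the rest of the principal generator. *)
  have [|w Lw ->] := Jgauss N (dvdnn N); first by rewrite gtnNdvd.
  rewrite (@big_cat_nat _ _ _ N.-1) ?leq_pred //=; last by rewrite -ltnS prednK.
  rewrite [\prod_(N.-1 <= _ < N) _](_ : _ = fac N.-1); last first.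
    by rewrite -{2}(prednK N0) big_nat1.
  have -> : fac N.-1 = - (s ^+ 2 * q ^ (2 - (2 * N)%N%:Z) - 1).
    rewrite /fac opprB; congr (1 - _ * _).
    have -> : 2 - (2 * N)%N%:Z = - (2 * N.-1)%N%:Z by lia.
    by rewrite -exprnN exprVn -exprM.
  set m := (_ - 1); set pr := \prod_(_ <= _ < _) _.
  have -> : w * cyclo_q2 q N * (pr * - m) = - (w * pr) * (cyclo_q2 q N * m) by ring.
  apply: ideal_genM; first by apply/LN/LM => //; apply: Lfac.
  exact: mem_ideal_gen.
set x := _ * _.
rewrite -[\big[_/_]_(d <- _ | _) _]big_filter; apply: (@ideal_mul_comaximal N) => //.
- by rewrite filter_uniq ?divisors_uniq.
- by apply/allP => d; rewrite mem_filter -dvdn_divisors // => /andP[].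
- by apply: LM; [rewrite gE; apply: laurent_evQ | apply: Lfac].
move=> d; rewrite mem_filter -dvdn_divisors // => /andP[/andP[d1 dN'] dN].
have d0 := dvdn_gt0 N0 dN.
have [dk|dk] := boolP (d %| k)%N; last first.
  have [w Lw Dw] := Jgauss d dN dk; rewrite /x Dw [X in J d X]mulrAC; apply: ideal_genM.
    by apply: LM => //; apply: Lfac.
  by apply: mem_ideal_gen; left.
(* Here d divides N - k > 0, so a full period of d factors fits into the product. *)
have kdN : (k + d <= N)%N.
  by rewrite -leq_subRL ?(ltnW kN) // dvdn_leq ?subn_gt0 // dvdn_sub.
rewrite /x (@big_cat_nat _ _ _ (k + d)) ?leq_addr //= mulrCA [X in J d X]mulrC.
apply: ideal_genM; last exact: ideal_prod_period.
by apply: LM; [rewrite gE; apply: laurent_evQ | apply: Lfac].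
Qed.

End LaurentIdeals.

(** * Partial traces of the R-matrix *)

Section Diagonal.

Variables (F : fieldType) (q s : F).

Lemma Rcoef_gen_small i j k : (i < j)%N -> Rcoef_gen q s i j k j = 0.
Proof.
move=> ij; rewrite /Rcoef_gen big_pred0 ?mulr0 // => m.
by apply/negP => /andP[_ /eqP]; lia.
Qed.

(** R preserves the sum of the two indices, so equal second indices force equal first ones. *)
Lemma Rcoef_gen_offdiag i j k : i != k -> Rcoef_gen q s i j k j = 0.
Proof.
move=> ik; rewrite /Rcoef_gen big_pred0 ?mulr0 // => m.
by apply: contraNF ik => /andP[/eqP + /eqP]; have := ltn_ord m; lia.
Qed.

Lemma Rinvcoef_gen_small i j k : (j < i)%N -> Rinvcoef_gen q s i j k j = 0.
Proof.
move=> ij; rewrite /Rinvcoef_gen big_pred0 ?mulr0 // => m.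
by apply/negP => /andP[_ /eqP]; lia.
Qed.

Lemma Rinvcoef_gen_offdiag i j k : i != k -> Rinvcoef_gen q s i j k j = 0.
Proof.
move=> ik; rewrite /Rinvcoef_gen big_pred0 ?mulr0 // => m.
by apply: contraNF ik => /andP[/eqP + /eqP]; have := ltn_ord m; lia.
Qed.

Lemma Rcoef_gen_diag j m :
  Rcoef_gen q s (j + m) j (j + m) j = s ^- (j + m + j) *
    (q ^+ (2 * j * (j + m)) * q ^+ (m * m.-1)./2 * qbin q (m + j) j *
     \prod_(a < m) (s * q ^- (a + j) - s^-1 * q ^+ (a + j))).
Proof.
have mP : (m < (j + m).+1)%N by rewrite ltnS leq_addl.
rewrite /Rcoef_gen (big_pred1 (Ordinal mP)) /=; first by rewrite addnK.
move=> a; apply/andP/eqP => [[/eqP /addnI ma _]|->]; last by rewrite /= addnK.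
exact/val_inj/esym.
Qed.

Lemma Rinvcoef_gen_diag i m :
  Rinvcoef_gen q s i (i + m) i (i + m) = s ^+ (i + (i + m)) *
    ((-1) ^+ m * q ^- (2 * i * (i + m)) * q ^- (m * m.-1)./2 * qbin q (m + i) i *
     \prod_(a < m) (s * q ^- (i + a) - s^-1 * q ^+ (i + a))).
Proof.
have mP : (m < (i + m).+1)%N by rewrite ltnS leq_addl.
rewrite /Rinvcoef_gen (big_pred1 (Ordinal mP)) //= => a.
apply/andP/eqP => [[_ /eqP /addnI ma]|->]; last by rewrite /= addnK.
exact/val_inj/esym.
Qed.

(** Inverting q changes the sign of both numerator and denominator of each quantum integer. *)
Lemma qbinV n k : qbin q^-1 n k = qbin q n k.
Proof.
have qfactV m : qfact q^-1 m = qfact q m.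
  apply: eq_bigr => l _; rewrite /qint !exprVn !invrK.
  by rewrite -(opprB (q ^+ l)) -(opprB q) invrN mulrNN.
by rewrite /qbin !qfactV.
Qed.

Hypotheses (q0 : q != 0) (s0 : s != 0).

(** Each factor is s q^-(a+j) (1 - s^-2 q^(2(a+j))); the units are collected in front. *)
Lemma prod_Rfactor j m :
  \prod_(a < m) (s * q ^- (a + j) - s^-1 * q ^+ (a + j)) =
  s ^+ m * q ^- (m * j) * q ^- (m * m.-1)./2 *
    \prod_(j <= k < j + m) (1 - s ^- 2 * (q ^+ 2) ^+ k).
Proof.
elim: m => [|m IHm]; first by rewrite big_ord0 addn0 big_geq // !expr0 invr1 !mulr1.
rewrite big_ord_recr IHm addnS big_nat_recr ?leq_addr //=.
have -> : ((m.+1 * m)./2 = m + (m * m.-1)./2)%N.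
  have -> : (m.+1 * m = m.*2 + m * m.-1)%N by case: m {IHm} => // m; lia.
  by rewrite halfD odd_double doubleK.
set Pi := \prod_(_ <= _ < _) _; set T := (_./2)%N.
rewrite mulSn -exprM mul2n -addnn [s ^+ m.+1]exprS !exprD.
have ? := expf_neq0 j q0; have ? := expf_neq0 m q0.
have ? := expf_neq0 T q0; have ? := expf_neq0 (m * j) q0.
by field; do ?[apply/andP; split].
Qed.

Hypothesis q_nroot1 : forall m, (0 < m)%N -> q ^+ m != 1.

Lemma qint_neq0 m : (0 < m)%N -> qint q m != 0.
Proof.
have H n : (0 < n)%N -> q ^+ n - q ^- n != 0.
  move=> n0; rewrite subr_eq0; apply: contraNneq (q_nroot1 (m := n + n) _).
    by move=> E; rewrite exprD {1}E mulVf ?expf_neq0.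
  by rewrite addn_gt0 n0.
by move=> m0; rewrite mulf_neq0 ?invr_eq0 ?H // (H 1%N).
Qed.

Lemma qfact_neq0 m : qfact q m != 0.
Proof.
rewrite /qfact prodf_seq_neq0; apply/allP => k; rewrite mem_index_iota => /andP[k0 _].
by apply/implyP => _; apply: qint_neq0.
Qed.

Lemma qfactS m : qfact q m.+1 = qfact q m * qint q m.+1.
Proof. by rewrite /qfact big_nat_recr. Qed.

(** Both sides satisfy the same ratio recursion in j, which for [gauss] is absorption divided by a
    non-zero element. *)
Lemma qbin_gauss m j : qbin q (m + j) j = q ^- (m * j) * gauss (q ^+ 2) (m + j) j.
Proof.
elim: j => [|j IHj].
  rewrite muln0 expr0 invr1 mul1r gauss0 /qbin subn0 addn0.
  by rewrite [qfact q 0]big_geq // mulr1 divff ?qfact_neq0.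
have Q1 n : (q ^+ 2) ^+ n.+1 - 1 != 0 by rewrite subr_eq0 -exprM q_nroot1.
have -> : gauss (q ^+ 2) (m + j.+1) j.+1 =
    ((q ^+ 2) ^+ (m + j).+1 - 1) / ((q ^+ 2) ^+ j.+1 - 1) * gauss (q ^+ 2) (m + j) j.
  by apply: (mulfI (Q1 j)); rewrite addnS gauss_absorb mulrA mulrCA divff ?mulr1.
have -> : qbin q (m + j.+1) j.+1 = qint q (m + j).+1 / qint q j.+1 * qbin q (m + j) j.
  rewrite /qbin !addnK addnS !qfactS; field.
  by rewrite !qfact_neq0 qint_neq0.
rewrite IHj; set G := gauss _ _ _; have q1 : q - q^-1 != 0.
  by apply: contraNneq (qint_neq0 (ltn0Sn 0)) => E; rewrite /qint E invr0 mulr0.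
have qint_Q n : qint q n.+1 = q ^- n.+1 * ((q ^+ 2) ^+ n.+1 - 1) / (q - q^-1).
  rewrite /qint mulrBr mulr1; congr ((_ - _) / _).
  by rewrite -exprM mul2n -addnn exprD mulKf ?expf_neq0.
rewrite !qint_Q [(m * j.+1)%N]mulnS [q ^+ (m + j).+1]exprS !exprD [q ^+ j.+1]exprS.
move: (Q1 j) (Q1 (m + j)%N); set B := _ - 1; set C := _ - 1 => B0 C0.
have ? := expf_neq0 j q0; have ? := expf_neq0 m q0; have ? := expf_neq0 (m * j) q0.
move: q1; set e := q - q^-1 => q1.
by field; do ?[apply/andP; split].
Qed.

(** The weight q^(-2j) is what turns the diagonal coefficient into the summand of [sum_gauss_prod]
    at x = q^2, z = s^-2. *)
Lemma Rcoef_gen_gauss j m :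
  q ^- (2 * j) * Rcoef_gen q s (j + m) j (j + m) j =
  (s ^- 2) ^+ j * (q ^+ 2) ^+ (j * j.-1) * gauss (q ^+ 2) (j + m) j *
    \prod_(j <= k < j + m) (1 - s ^- 2 * (q ^+ 2) ^+ k).
Proof.
rewrite Rcoef_gen_diag prod_Rfactor qbin_gauss [in gauss _ _ _]addnC.
set Pi := \prod_(_ <= _ < _) _; set G := gauss _ _ _; set T := (_./2)%N.
have -> : (2 * j * (j + m) = 2 * j + 2 * (j * j.-1) + m * j + m * j)%N.
  by case: j {Pi G} => [|j]; lia.
have -> : (j + m + j = 2 * j + m)%N by lia.
rewrite exprVn -!exprM !exprD.
by field; rewrite !expf_neq0.
Qed.

Lemma Rcoef_gen_trace N i : (i < N)%N ->
  \sum_(j < N) q ^- (2 * j) * Rcoef_gen q s i j i j = 1.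
Proof.
move=> iN; rewrite -(big_mkord predT (fun j => q ^- (2 * j) * Rcoef_gen q s i j i j)).
rewrite (@big_cat_nat _ _ _ i.+1) //= [X in _ + X]big_nat_cond [X in _ + X]big1 => [|j].
  rewrite addr0 -[RHS](sum_gauss_prod (q ^+ 2) (s ^- 2) i).
  by apply: eq_big_nat => j /andP[_]; rewrite ltnS => /subnKC <-; rewrite Rcoef_gen_gauss.
by rewrite andbT => /andP[ij _]; rewrite Rcoef_gen_small ?mulr0.
Qed.

End Diagonal.

(** * The weighted trace of the inverse R-matrix *)

Section InverseTrace.

Variables (F : fieldType) (q s : F).
Hypotheses (q0 : q != 0) (s0 : s != 0).
Hypothesis q_nroot1 : forall m, (0 < m)%N -> q ^+ m != 1.

Let qV_nroot1 m : (0 < m)%N -> q^-1 ^+ m != 1.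
Proof. by move=> m0; rewrite exprVn invr_eq1 q_nroot1. Qed.

Lemma gaussV m k : gauss (q ^- 2) (m + k) k = (q ^- 2) ^+ (m * k) * gauss (q ^+ 2) (m + k) k.
Proof.
have := qbinV q (m + k) k.
rewrite !qbin_gauss ?invr_eq0 // !exprVn !invrK => E.
apply: (mulfI (expf_neq0 (m * k) q0)); rewrite E mulrA; congr (_ * _).
by rewrite -exprM mul2n -addnn exprD invfM mulrA divff ?mul1r ?expf_neq0.
Qed.

Lemma Rinvcoef_gen_gauss i m :
  q ^- (2 * (i + m)) * Rinvcoef_gen q s i (i + m) i (i + m) =
  (s ^+ 2) ^+ i * (q ^- 2) ^+ (i * i + (i + m)) * gauss (q ^- 2) (i + m) i *
    \prod_(i <= k < i + m) (1 - s ^+ 2 * (q ^- 2) ^+ k).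
Proof.
(* The sign (-1)^m, absorbed factor by factor, yields the product of [prod_Rfactor] for the
   parameters q^-1 and s^-1. *)
have -> : Rinvcoef_gen q s i (i + m) i (i + m) = s ^+ (i + (i + m)) *
    (q ^- (2 * i * (i + m)) * q ^- (m * m.-1)./2 * qbin q (m + i) i *
    \prod_(a < m) (s^-1 * q^-1 ^- (a + i) - s^-1^-1 * q^-1 ^+ (a + i))).
  rewrite Rinvcoef_gen_diag; congr (_ * _); move: (qbin _ _ _) => B; rewrite -!mulrA mulrCA.
  congr (_ * _); rewrite mulrCA; congr (_ * _); rewrite mulrCA; congr (_ * _).
  have -> : (-1) ^+ m = \prod_(a < m) (-1) :> F by rewrite prodr_const card_ord.
  rewrite -big_split; apply: eq_bigr => a _ /=.
  by rewrite !exprVn !invrK mulN1r opprB [(i + a)%N]addnC.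
rewrite prod_Rfactor ?invr_eq0 // -qbinV qbin_gauss ?invr_eq0 //.
rewrite !exprVn !invrK [(m + i)%N]addnC.
set Pi := \prod_(_ <= _ < _) _; set G := gauss _ _ _; set T := (_./2)%N.
rewrite -!exprM.
have -> : (2 * i * (i + m) = 2 * (i * i) + m * i + m * i)%N by lia.
have -> : (2 * (i * i + (i + m)) = 2 * (i * i) + 2 * (i + m))%N by lia.
have -> : (i + (i + m) = 2 * i + m)%N by lia.
by rewrite !exprD; field; rewrite !expf_neq0.
Qed.

Variable c : {rmorphism rat -> F}.
Hypothesis s2n1 : s ^+ 2 != 1.

Let A := laurent c q s.

Lemma Rinvcoef_gen_trace N i : (i < N)%N ->
  ideal_gen A (Itilde_gen c q s N)
    (\sum_(j < N) q ^- (2 * j) * Rinvcoef_gen q s i j i j -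
     (s ^+ 2) ^+ N.-1 * (q ^- 2) ^+ (N * N.-1)).
Proof.
move=> iN; pose T i := \sum_(i <= j < N) (s ^+ 2) ^+ i * (q ^- 2) ^+ (i * i + j) *
  gauss (q ^- 2) j i * \prod_(i <= k < j) (1 - s ^+ 2 * (q ^- 2) ^+ k).
have -> : \sum_(j < N) q ^- (2 * j) * Rinvcoef_gen q s i j i j = T i.
  rewrite -(big_mkord predT (fun j => q ^- (2 * j) * Rinvcoef_gen q s i j i j)).
  rewrite (@big_cat_nat _ _ _ i) ?(ltnW iN) //= big_nat_cond big1 => [|j].
    rewrite add0r; apply: eq_big_nat => j /andP[/subnKC <- _].
    by rewrite Rinvcoef_gen_gauss.
  by rewrite andbT => /andP[_ ji]; rewrite Rinvcoef_gen_small ?mulr0.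
(* Descending induction on k, with m = N - 1 - k; the base case T (N-1) consists of a single
   term. *)
suff H m k : (k + m).+1 = N -> ideal_gen A (Itilde_gen c q s N)
    (T k - (s ^+ 2) ^+ N.-1 * (q ^- 2) ^+ (N * N.-1)).
  by apply: (H (N - i.+1)%N); rewrite -addSn subnKC.
elim: m k => [|m IHm] k kmN.
  have Nk : N = k.+1 by rewrite -kmN addn0.
  rewrite /T Nk big_nat1 gauss_nn big_geq // !mulr1 -mulSnr subrr.
  exact: ideal_gen0.
have kN : (k.+1 < N)%N by lia.
rewrite /T sum_gauss_telescope ?(ltnW kN) // addrAC addrC.
(* The telescoping binomial is at q^-2; it is a unit times the one at q^2 handled by
   [Itilde_gen_gauss]. *)
have -> : gauss (q ^- 2) N k.+1 =
    (q ^- 2) ^+ ((N - k.+1) * k.+1) * gauss (q ^+ 2) N k.+1.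
  by have := gaussV (N - k.+1) k.+1; rewrite subnK // ltnW.
set G := gauss _ _ _; set Pi := \prod_(_ <= _ < N) _.
rewrite mulrA -[_ * G * Pi]mulrA; apply: ideal_genMD => //; last first.
- by apply: IHm; rewrite addSnnS.
- exists [:: (1, G * Pi)]; rewrite big_seq1 mul1r; split=> // t.
  rewrite inE => /eqP -> /=; split; first exact: laurent1.
  exact: Itilde_gen_gauss.
- rewrite -mulrA -exprD -exprM !exprVn -exprM exprnN mulrC.
  by rewrite [s ^+ _]exprnP; apply: laurent_monomial.
Qed.

End InverseTrace.

(** * Partial traces of braid operators *)

Lemma laurent_monomialM (F : fieldType) (u v : F) (a b a' b' : int) :
  u != 0 -> v != 0 ->
  (u ^ a * v ^ b) * (u ^ a' * v ^ b') = u ^ (a + a') * v ^ (b + b').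
Proof. by move=> u0 v0; rewrite !expfzDr // mulrACA. Qed.

Section Coefficients.

Variable N : nat.

Lemma val_monomial a b : val (monomial a b) = q ^ a * s ^ b.
Proof. by []. Qed.

Lemma monomialM a b a' b' :
  monomial a b * monomial a' b' = monomial (a + a') (b + b').
Proof.
apply: val_inj; rewrite rmorphM !val_monomial.
exact: laurent_monomialM q_neq0 s_neq0.
Qed.

Lemma monomial0 : monomial 0 0 = 1.
Proof. by apply: val_inj; rewrite rmorph1 val_monomial !expr0z mulr1. Qed.

Lemma monomial_q j : val (monomial (- (2 * j)%N%:Z) 0) = q ^- (2 * j).
Proof. by rewrite val_monomial expr0z mulr1 -exprnN. Qed.

Lemma Rcoef_offdiag e i j k : i != k -> Rcoef e i j k j = 0.
Proof.
move=> ik; apply: val_inj; rewrite rmorph0.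
by case: e => /=; [apply: Rcoef_gen_offdiag | apply: Rinvcoef_gen_offdiag].
Qed.

Lemma Rcoef_small i j : (i < j)%N -> Rcoef true i j i j = 0.
Proof. by move=> ij; apply: val_inj; rewrite rmorph0 /= Rcoef_gen_small. Qed.

(** A monomial is a unit, so the triangular system for the g_j has invertible diagonal. *)
Lemma Rcoef_ii i : Rcoef true i i i i = monomial (2 * i * i)%N (- (i + i)%N%:Z).
Proof.
apply: val_inj => /=; have := Rcoef_gen_diag q s i 0.
rewrite addn0 => ->; have := qbin_gauss q_neq0 q_nroot1 0 i.
rewrite add0n => ->; rewrite gauss_nn mul0n big_ord0 expr0 invr1 !mulr1.
by rewrite -exprnN -exprnP mulrC.
Qed.

Lemma Rcoef_true_trace i : (i < N)%N ->
  \sum_(j < N) toAN N (monomial (- (2 * j)%N%:Z) 0) * toAN N (Rcoef true i j i j) = 1.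
Proof.
move=> iN; under eq_bigr => j _ do rewrite -rmorphM.
rewrite -rmorph_sum -[RHS](rmorph1 (toAN N)); congr (toAN N _); apply: val_inj.
rewrite rmorph1 -[RHS](Rcoef_gen_trace q_neq0 s_neq0 q_nroot1 iN) rmorph_sum.
by apply: eq_bigr => j _; rewrite rmorphM -monomial_q.
Qed.

Lemma s2_neq1 : s ^+ 2 != 1.
Proof.
rewrite -(rmorph1 Defs.frac) -rmorphXn (inj_eq frac_inj); apply/eqP.
by move=> /(congr1 (fun p : {poly {poly rat}} => size p)); rewrite size_polyXn size_poly1.
Qed.

(** Unlike [Rcoef_true_trace], whose proof takes place in A, this comes from a congruence modulo the
    ideal. *)
Lemma Rcoef_false_trace i : (i < N)%N ->
  \sum_(j < N) toAN N (monomial (- (2 * j)%N%:Z) 0) * toAN N (Rcoef false i j i j) =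
  toAN N (monomial (- (2 * (N * N.-1))%N%:Z) (2 * N.-1)%N).
Proof.
move=> iN; under eq_bigr => j _ do rewrite -rmorphM.
rewrite -rmorph_sum; apply/eqP; rewrite -Quotient.idealrBE; apply/asboolP.
have := Rinvcoef_gen_trace q_neq0 s_neq0 q_nroot1 ratK s2_neq1 iN.
rewrite rmorphB rmorph_sum /=; congr (ideal_gen _ _ (_ - _)).
  by apply: eq_bigr => j _; rewrite expr0z mulr1 -exprnN.
by rewrite mulrC -exprnN -exprnP exprVn -!exprM.
Qed.

End Coefficients.

Arguments Rcoef : simpl never.

Section Tuples.

Variables (N n : nat).
Implicit Types (I J : n.-tuple 'I_N) (j : 'I_N).

Lemma entryE I (k : 'I_n) : entry I k = tnth I k.
Proof. by rewrite /entry (nth_map (tnth I k)) ?size_tuple // -tnth_nth. Qed.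

Lemma entry_lt I k : (k < n)%N -> (entry I k < N)%N.
Proof. by move=> kn; rewrite (entryE I (Ordinal kn)). Qed.

Lemma eq_entry I J : (forall k, (k < n)%N -> entry I k = entry J k) -> I = J.
Proof.
by move=> IJ; apply: eq_from_tnth => k; apply: val_inj; rewrite /= -!entryE IJ.
Qed.

Lemma entry_rcons I j k : (k < n)%N -> entry [tuple of rcons I j] k = entry I k.
Proof. by move=> kn; rewrite /entry map_rcons nth_rcons size_map size_tuple kn. Qed.

Lemma entry_rcons_last I j : entry [tuple of rcons I j] n = j.
Proof. by rewrite /entry map_rcons nth_rcons size_map size_tuple ltnn eqxx. Qed.

Lemma agreeP i I J :
  reflect (forall k, (k < n)%N -> k != i.-1 -> k != i -> entry I k = entry J k)
    [forall k : 'I_n, (k != i.-1 :> nat) && (k != i :> nat) ==>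
                       (tnth I k == tnth J k)].
Proof.
apply: (iffP forallP) => [IJ k kn k1 k2 | IJ k].
  have := IJ (Ordinal kn); rewrite /= k1 k2 => /eqP IJk.
  by rewrite -[k]/(val (Ordinal kn)) !entryE IJk.
by apply/implyP => /andP[k1 k2]; apply/eqP/val_inj; rewrite /= -!entryE IJ.
Qed.

Lemma rcons_bij :
  bijective (fun p : n.-tuple 'I_N * 'I_N => [tuple of rcons p.1 p.2] : n.+1.-tuple 'I_N).
Proof.
apply: inj_card_bij; last by rewrite card_prod !card_tuple card_ord expnSr.
move=> [I j] [J j'] /(congr1 val) /= /rcons_inj [IJ ->].
by congr (_, _); apply: val_inj.
Qed.

Lemma rconsP (T : n.+1.-tuple 'I_N) : exists I j, T = [tuple of rcons I j].
Proof. by have [f _ fK] := rcons_bij; exists (f T).1, (f T).2; rewrite fK. Qed.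

Lemma sum_rcons (V : nmodType) (f : n.+1.-tuple 'I_N -> V) :
  \sum_T f T = \sum_(I : n.-tuple 'I_N) \sum_(j < N) f [tuple of rcons I j].
Proof.
rewrite (reindex _ (onW_bij _ rcons_bij)) /=.
by rewrite (pair_big predT predT (fun I j => f [tuple of rcons I j])).
Qed.

Lemma eq_rcons I J j j' :
  ([tuple of rcons I j] == [tuple of rcons J j']) = (I == J) && (j == j').
Proof. by rewrite -!val_eqE /= eqseq_rcons. Qed.

End Tuples.

(** * Adding a strand and tracing it out *)

Section PartialTrace.

Variables (N n : nat).
Implicit Types (I J : n.-tuple 'I_N) (j : 'I_N) (x : tens N n).

Lemma sigma_coef_rcons e i I J j j' : (0 < i < n)%N ->
  sigma_coef e i [tuple of rcons I j] [tuple of rcons J j'] =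
  if j == j' then sigma_coef e i I J else 0.
Proof.
move=> /andP[i0 i_n]; have i1n : (i.-1 < n)%N by lia.
rewrite /sigma_coef !entry_rcons //.
case: (j =P j') => [<-|jj'].
  congr (if _ then _ else _); apply/agreeP/agreeP => IJ k kn k1 k2.
    by rewrite -(entry_rcons I j kn) IJ ?entry_rcons // ltnW.
  move: kn; rewrite ltnS leq_eqVlt => /predU1P[-> | kn].
    by rewrite !entry_rcons_last.
  by rewrite !entry_rcons // IJ.
(* Position n is neither i - 1 nor i, so agreement there would force j = j'. *)
case: agreeP => // /(_ n (ltnSn n)); rewrite !entry_rcons_last => jj.
by case: jj'; apply/val_inj/jj; lia.
Qed.

(* [x |-> x (x) v_j] *)
Definition tensv j x : tens N n.+1 :=
  [ffun T => \sum_I x I * (T == [tuple of rcons I j])%:R].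

Lemma tensvE j x J j' : tensv j x [tuple of rcons J j'] = if j' == j then x J else 0.
Proof.
rewrite ffunE (bigD1 J) //= big1 => [|I IJ].
  by rewrite addr0 eq_rcons eqxx /=; case: eqP; rewrite ?mulr1 ?mulr0.
by rewrite eq_rcons eq_sym (negPf IJ) mulr0.
Qed.

Lemma tensv_linear j : linear (tensv j).
Proof.
move=> a x y; apply/ffunP => T; have [I [j' ->]] := rconsP T.
rewrite tensvE [RHS]ffunE [X in _ = X + _]ffunE !tensvE; case: eqP => _; first by rewrite !ffunE.
by rewrite scaler0 addr0.
Qed.

HB.instance Definition _ j :=
  GRing.isLinear.Build (AN N) (tens N n) (tens N n.+1) *:%R (tensv j) (tensv_linear j).

Lemma tensv_vbasis j I : tensv j (Defs.vbasis I) = Defs.vbasis [tuple of rcons I j].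
Proof.
apply/ffunP => T; have [J [j' ->]] := rconsP T.
by rewrite tensvE !ffunE eq_rcons; case: eqP; rewrite ?andbT ?andbF.
Qed.

Lemma sigma_fun_tensv e i j x : (0 < i < n)%N ->
  sigma_fun e i (tensv j x) = tensv j (sigma_fun e i x).
Proof.
move=> i_n; apply/ffunP => T; have [J [j' ->]] := rconsP T.
rewrite tensvE !ffunE sum_rcons.
under eq_bigr => I _.
  rewrite (bigD1 j) //= big1 ?addr0; last first.
    by move=> k kj; rewrite tensvE (negPf kj) mul0r.
  rewrite tensvE eqxx sigma_coef_rcons //.
  over.
rewrite [j' == j]eq_sym; case: eqP => // _.
by rewrite big1 // => I _; rewrite mulr0.
Qed.

(** A braid on the first n strands acts as the identity on the added one, generator by generator. *)
Lemma rho_tensv w j x : w \in braid_word n ->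
  rho N n.+1 w (tensv j x) = tensv j (rho N n w x).
Proof.
elim: w => [//|[i e] w IHw] /andP[i_n wn] /=.
by rewrite IHw // sigma_fun_tensv.
Qed.

(** Stated on arbitrary vectors through x (x) v_j, so that composition of operators can be used
    without matrix products; [tensv_vbasis] gives back the coefficient formula. *)
Definition ptr_fun (g : 'I_N -> AN N) (f : endo N n.+1) x : tens N n :=
  [ffun J : n.-tuple 'I_N => \sum_j g j * f (tensv j x) [tuple of rcons J j]].

Lemma ptr_linear g f : linear (ptr_fun g f).
Proof.
move=> a x y; apply/ffunP => J; rewrite !ffunE scaler_sumr -big_split /=.
apply: eq_bigr => j _; rewrite !linearP !ffunE mulrDr; congr (_ + _).
exact: mulrCA.
Qed.

HB.instance Definition _ g f := GRing.isLinear.Build (AN N) (tens N n) (tens N n)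
  *:%R (ptr_fun g f) (ptr_linear g f).

Definition ptr g f : endo N n := ptr_fun g f.

End PartialTrace.

Section LastStrand.

Variables (N n : nat).
Implicit Types (I J : n.+1.-tuple 'I_N) (j : 'I_N).

(** The last generator acts on positions n and n + 1, counted from 0. With equal last entries,
    conservation of the index sum makes the matrix diagonal. *)
Lemma sigma_coef_last e I J j :
  sigma_coef e n.+1 [tuple of rcons I j] [tuple of rcons J j] =
  if I == J then toAN N (Rcoef e (entry I n) j (entry I n) j) else 0.
Proof.
rewrite /sigma_coef /= !(entry_rcons _ _ (ltnSn n)) !entry_rcons_last.
case: (agreeP n.+1) => [/= agr | disagr].
  have [-> // | /eqP IJ] := eqVneq I J.
  rewrite Rcoef_offdiag ?rmorph0 //; apply: contra_notN IJ => /eqP nIJ.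
  apply: eq_entry => k kn; have [-> // | k_n] := eqVneq k n.
  have kn2 : k != n.+1 by lia.
  have := agr k (ltnW kn) k_n kn2; rewrite !entry_rcons //.
by case: eqP => // IJ; case: disagr => k; rewrite IJ.
Qed.

(** Tracing out the last strand leaves a diagonal operator whose eigenvalue depends only on the last
    remaining entry i; if it does not vary with i, it is a scalar multiplying [rho N n.+1 w]. *)
Lemma ptr_sigma_last (g : 'I_N -> AN N) e w a : w \in braid_word n.+1 ->
  (forall i, (i < N)%N -> \sum_j g j * toAN N (Rcoef e i j i j) = a) ->
  ptr g (rho N n.+2 ((n.+1, e) :: w)) =1 a \*: rho N n.+1 w.
Proof.
move=> wn tr x; apply/ffunP => J; rewrite !ffunE /=.
under eq_bigr => j _.
  rewrite rho_tensv // ffunE sum_rcons mulr_sumr.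
  under eq_bigr => I _.
    rewrite (bigD1 j) //= big1 ?addr0; last first.
      by move=> k kj; rewrite tensvE (negPf kj) mul0r.
    rewrite tensvE eqxx sigma_coef_last.
    over.
  over.
rewrite exchange_big /= (bigD1 J) //= [X in _ + X]big1 ?addr0 => [|I /negPf IJ]; last first.
  by rewrite big1 // => j _; rewrite IJ !mulr0.
rewrite -[a *: _]/(a * _) -(tr (entry J n)) ?entry_lt // mulr_suml.
by apply: eq_bigr => j _; rewrite eqxx mulrCA mulrC.
Qed.

End LastStrand.

(** * Existence and uniqueness of the quantum partial trace *)

Theorem theorem1p6 (N n : nat) (hN : (2 <= N)%N) (hn : (1 <= n)%N) :
  (exists (g : 'I_N -> AN N) (qptr : endo N n.+1 -> endo N n), is_qptr g qptr) /\
  (forall (g : 'I_N -> AN N) (qptr : endo N n.+1 -> endo N n), is_qptr g qptr ->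
     let g0 := g (Ordinal (ltnW hN)) in
     g0 != 0 /\ forall j : 'I_N, g j = g0 * toAN N (monomial (- (2 * j)%N%:Z) 0)).
Proof.
case: n hn => // {}n _; split.
  (* With T = q^(-2N(N-1)) s^(2(N-1)) the trace of R^-1 for the weights q^(-2j), the choice a^2 T =
     1 makes a T equal to a^-1. *)
  pose a := toAN N (monomial (N * N.-1)%N (- N.-1%:Z)).
  pose a' := toAN N (monomial (- (N * N.-1)%N%:Z) N.-1).
  pose g (j : 'I_N) := a * toAN N (monomial (- (2 * j)%N%:Z) 0).
  exists g, (ptr g); split.
    move=> f I J; rewrite /mcoef ffunE; apply: eq_bigr => j _.
    by rewrite tensv_vbasis.
  exists a, a'; split; first by rewrite -rmorphM monomialM !(subrr, addNr) monomial0 rmorph1.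
  move=> w wn; split; apply: ptr_sigma_last => // i iN;
    under eq_bigr => j _ do rewrite -mulrA.
  - by rewrite -mulr_sumr Rcoef_true_trace // mulr1.
  - rewrite -mulr_sumr Rcoef_false_trace // -rmorphM monomialM.
    by congr (toAN N (monomial _ _)); lia.
move=> g qptr [qptrE [a [a' [aa' qptr_rho]]]] g0.
have trE i : (i < N)%N -> \sum_j g j * toAN N (Rcoef true i j i j) = a.
  (* The constant tuple serves as a basis vector whose last entry is i; the braid is trivial. *)
  move=> iN; pose I := [tuple of nseq n.+1 (Ordinal iN)].
  have Ii : entry I n = i by rewrite /entry map_nseq nth_nseq ltnSn.
  have [/(_ (Defs.vbasis I)) /(congr1 (fun x : tens N n.+1 => x I)) + _] := qptr_rho [::] isT.
  have := qptrE (rho N n.+2 [:: (n.+1, true)]) I I; rewrite /mcoef => ->.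
  rewrite !ffunE eqxx => E; rewrite -[RHS]mulr1 -[RHS]E; apply: eq_bigr => j _.
  congr (_ * _); rewrite ffunE (bigD1 [tuple of rcons I j]) //= big1.
    by rewrite addr0 ffunE eqxx mul1r sigma_coef_last eqxx Ii.
  by move=> T /negPf TI; rewrite ffunE TI mul0r.
have ag0 : a = g0.
  rewrite -(trE 0 (ltnW hN)) (bigD1 (Ordinal (ltnW hN))) //= big1 ?addr0.
    by rewrite Rcoef_ii monomial0 rmorph1 mulr1.
  move=> j j0; rewrite Rcoef_small ?rmorph0 ?mulr0 //.
  by rewrite lt0n; apply: contra_neq j0 => j0; apply: val_inj.
rewrite -ag0; split.
  by apply: contra_eq_neq aa' => ->; rewrite mul0r eq_sym oner_neq0.
move=> j; have [m] := ubnP (val j); elim: m j => // m IHm j; rewrite ltnS => jm.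
(* The deviation h from the expected solution satisfies the homogeneous system: in equation j, terms
   with k < j vanish by induction and those with k > j by triangularity. *)
pose h k := g k - a * toAN N (monomial (- (2 * val k)%N%:Z) 0).
have : \sum_k h k * toAN N (Rcoef true j k j k) = 0.
  under eq_bigr => k _ do rewrite mulrBl -mulrA.
  by rewrite sumrB -mulr_sumr trE // Rcoef_true_trace // mulr1 subrr.
rewrite (bigD1 j) //= big1 => [|k kj]; last first.
  case: (ltngtP (val j) (val k)) => [jk | kj' | /val_inj jk].
  - by rewrite Rcoef_small // rmorph0 mulr0.
  - by rewrite /h IHm ?subrr ?mul0r // (leq_trans kj').
  - by rewrite jk eqxx in kj.
(* Multiplication by the inverse of the diagonal monomial isolates h j. *)
rewrite addr0 Rcoef_ii => /(congr1 (fun y => y *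
  toAN N (monomial (- (2 * j * j)%N%:Z) (j + j)%N))).
rewrite -mulrA -rmorphM monomialM subrr addNr monomial0 rmorph1 mulr1 mul0r.
by move/eqP; rewrite subr_eq0 => /eqP.
Qed.
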